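(* Let $A$ be a real finite-dimensional affine space and $m\in\mathrm{Met}(A)$ a non-degenerate metric. The Cayley–Menger bilinear form $\mathrm{CM}_m:\mathrm{Aff}(\mathrm{Quad}_mA)\to\widehat{\mathrm{Quad}_mA}$ is invertible, and the Cayley–Menger quadratic mapping $\delta^m:A\to\mathrm{Quad}_mA$, $P\mapsto\delta^m_P$, is an immersion (i.e. injective). For $\delta\in\widehat{\mathrm{Quad}_mA}$, $$\delta\in\mathrm{Im}\,\delta^m\iff\mathrm{CM}_m^{-1}(\delta,\delta)=0\ \text{ and }\ \mathrm{CM}_m^{-1}(\delta,u_m)=1.$$
   Context: All spaces are real and finite-dimensional. For an affine space $A$ with director vector space $\vec A$: $\mathrm{Aff}(A)$ is the vector space of affine functions $A\to\mathbb R$, $u$ the constant function $1$. The linear hull is $\widehat A=(\mathrm{Aff}(A))^*$; $z_P\in\widehat A$ is evaluation at $P$; $A$ is identified with $\{z:\langle z,u\rangle=1\}$ and $\vec A$ with $\{z:\langle z,u\rangle=0\}$, $\overrightarrow{PQ}=z_Q-z_P$. A map $\delta:A\to B$ between affine spaces is quadratic if $\delta(\alpha P+\beta Q)=\alpha(\alpha-\beta)\delta(P)+\beta(\beta-\alpha)\delta(Q)+4\alpha\beta\,\delta(\frac{P+Q}2)$ whenever $\alpha+\beta=1$; $\mathrm{Quad}(A)$ is the vector space of quadratic functions $A\to\mathbb R$. Each $\delta\in\mathrm{Quad}(A)$ has a symmetric bilinear form $\mathrm{Hess}\,\delta$ on $\vec A$ (hessian principal component), characterized by $\frac12(\delta(Q)+\delta(2P-Q))-\delta(P)=\frac12\mathrm{Hess}\,\delta(\overrightarrow{PQ},\overrightarrow{PQ})$.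 $\mathrm{Met}(A)=\mathrm{Quad}(A)/\mathrm{Aff}(A)$ is the space of metrics; for $m\in\mathrm{Met}(A)$, $\mathrm{Quad}_mA\subset\mathrm{Quad}(A)$ is the class $m$, an affine space with director space $\mathrm{Aff}(A)$; its elements share the same hessian principal component $g$ (that of $m$). $m$ is non-degenerate if $g$ has trivial nullspace. $\delta^m_P\in\mathrm{Quad}_mA$ is $\delta^m_P(Q)=\frac12g(\overrightarrow{PQ},\overrightarrow{PQ})$. $\mathrm{Aff}(\mathrm{Quad}_mA)$ is the vector space of affine functionals $\mathrm{Quad}_mA\to\mathbb R$; its dual is the linear hull $\widehat{\mathrm{Quad}_mA}$, in which $\mathrm{Quad}_mA$ is embedded by evaluation. $v_P(\delta)=\delta(P)$ for $P\in A$. $\mathrm d_m:\mathrm{Aff}(\mathrm{Quad}_mA)\to\widehat A$, $\langle\mathrm d_m\bar v,s\rangle=\bar v(\delta+s)-\bar v(\delta)$ (any $\delta\in \mathrm{Quad}_mA$); $u_m=u\circ\mathrm d_m\in\widehat{\mathrm{Quad}_mA}$, i.e. $\langle u_m,\bar v\rangle=\bar v(\delta+u)-\bar v(\delta)$. $\mathrm{Aff}_0(\mathrm{Quad}_mA)=\{\bar v:\langle u_m,\bar v\rangle=0\}$; $\mathrm d_m$ maps it into $\vec A$. A bilinear form $\Phi$ on $V$ is also viewed as a linear map $V\to V^*$, $v\mapsto\Phi(v,\cdot)$; if invertible, $\Phi^{-1}$ is the bilinear form on $V^*$ given by $\Phi^{-1}(a,b)=\langle \Phi^{-1}(a),b\rangle$.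 $\mathrm{CM}_m$ is the unique symmetric bilinear form on $\mathrm{Aff}(\mathrm{Quad}_mA)$ with (1) $\mathrm{CM}_m(v_1,v_2)=-g(\mathrm d_mv_1,\mathrm d_mv_2)$ for $v_1,v_2\in\mathrm{Aff}_0(\mathrm{Quad}_mA)$ and (2) $\mathrm{CM}_m(v_P)=\delta^m_P$ for all $P\in A$ (for $m\ne0$, (2) may equivalently be replaced by $\mathrm{CM}_m(v_P,v_P)=0$ for all $P\in A$). *)

(* Defs.v *)
From HB Require Import structures.
From mathcomp Require Import all_boot all_order all_algebra.
From mathcomp Require Import ring lra.
From mathcomp Require Import boolp classical_sets functions reals.
Import Order.TTheory GRing.Theory Num.Theory.

Set Implicit Arguments.
Unset Strict Implicit.
Unset Printing Implicit Defensive.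

Local Open Scope ring_scope.
Local Open Scope quotient_scope.

(* An affine space with director space V: a non-empty set on which V acts
   simply transitively; vec P Q is the vector from P to Q. The director is an
   arbitrary module so that the classes quadm below are affine spaces too;
   finite-dimensional affine spaces are those whose director is a vectType. *)
HB.mixin Record isAffine (R : nzRingType) (V : lmodType R) (A : Type) := {
  trans : A -> V -> A;
  vec : A -> A -> V;
  affine_inhabited : inhabited A;
  trans_vec : forall P Q, trans P (vec P Q) = Q;
  vec_trans : forall P x, vec P (trans P x) = x;
  transD : forall P x y, trans P (x + y) = trans (trans P x) y
}.

#[short(type="affineType")]
HB.structure Definition Affine (R : nzRingType) (V : lmodType R) :=
  {A of isAffine R V A}.

(* The barycentric combination a P + b Q, where a = 1 - b. *)
Definition bary (R : nzRingType) (V : lmodType R) (A : affineType V) (b : R)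
  (P Q : A) : A := trans P (b *: vec P Q).

Section AffineTheory.
Context {R : nzRingType} {V : lmodType R} {A : affineType V}.
Implicit Types (P Q : A) (x y : V).

Lemma vecPP P : vec P P = 0.
Proof.
have e : trans P (vec P P + vec P P) = P by rewrite transD !trans_vec.
have := vec_trans P (vec P P + vec P P); rewrite e.
by move/eqP; rewrite -subr_eq0 opprD addrA subrr sub0r oppr_eq0 => /eqP.
Qed.

Lemma trans0 P : trans P 0 = P.
Proof. by rewrite -(vecPP P) trans_vec. Qed.

Lemma vecD P Q (S : A) : vec P S = vec P Q + vec Q S.
Proof. by rewrite -[S in LHS](trans_vec Q) -{1}(trans_vec P Q) -transD vec_trans. Qed.

Lemma vec_transr O P x : vec O (trans P x) = vec O P + x.
Proof. by rewrite (vecD O P) vec_trans. Qed.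

Lemma vecN P Q : vec Q P = - vec P Q.
Proof. by apply/eqP; rewrite -addr_eq0 -vecD vecPP. Qed.

Lemma vec_via O P Q : vec P Q = (-1) *: vec O P + 1 *: vec O Q.
Proof. by rewrite scale1r scaleN1r -vecN -vecD. Qed.

Lemma vec_bary O b P Q :
  vec O (bary b P Q) = (1 - b) *: vec O P + b *: vec O Q.
Proof.
rewrite /bary vec_transr (vecD P O Q) (vecN O P) scalerDr scalerN scalerBl.
by rewrite scale1r addrA.
Qed.

End AffineTheory.

(* Two elements of a dual space, or of a space of bilinear forms, are equal as
   soon as they are equal as functions. *)
Lemma scalarP (R : comNzRingType) (U : lmodType R) (f g : {scalar U}) :
  f =1 g -> f = g.
Proof.
case: f => f [[f1] [f2]]; case: g => g [[g1] [g2]] /= /funext e.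
case: _ / e g1 g2 => g1 g2.
by rewrite (Prop_irrelevance f1 g1) (Prop_irrelevance f2 g2).
Qed.

Lemma biscalarP (R : comNzRingType) (U : lmodType R) (f g : {biscalar U}) :
  f =2 g -> f = g.
Proof.
case: f => f [[f1 f2 f3 f4]]; case: g => g [[g1 g2 g3 g4]] /= e.
have {}e : f = g by apply/funext => x; apply/funext => y; exact: e.
case: _ / e g1 g2 g3 g4 => g1 g2 g3 g4.
rewrite (Prop_irrelevance f1 g1) (Prop_irrelevance f2 g2).
by rewrite (Prop_irrelevance f3 g3) (Prop_irrelevance f4 g4).
Qed.

Section Functions.
Context {R : realType} {V : lmodType R} {A : affineType V}.

Definition is_affine (f : A -> R) :=
  forall (a b : R) (P Q : A), a + b = 1 ->
    f (bary b P Q) = a * f P + b * f Q.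

Definition is_quadratic (f : A -> R) :=
  forall (a b : R) (P Q : A), a + b = 1 ->
    f (bary b P Q) = a * (a - b) * f P + b * (b - a) * f Q
                     + 4 * a * b * f (bary 2^-1 P Q).

Definition affine_pred : {pred A -> R^o} := fun f => `[< is_affine f >].
Definition quadratic_pred : {pred A -> R^o} := fun f => `[< is_quadratic f >].

Let fct0E (P : A) : (0 : A -> R^o) P = 0 :> R. Proof. by []. Qed.
Let fctDE (f g : A -> R^o) P : (f + g) P = f P + g P :> R. Proof. by []. Qed.
Let fctZE k (f : A -> R^o) P : (k *: f) P = k * f P :> R. Proof. by []. Qed.

Lemma affine_submod : subsemimod_closed affine_pred.
Proof.
split; [split|].
- by apply/asboolP => a b P Q _; rewrite fct0E !mulr0 addr0.
- move=> f g /asboolP hf /asboolP hg; apply/asboolP => a b P Q h.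
  by rewrite !fctDE (hf a b)// (hg a b)//; ring.
- move=> k f /asboolP hf; apply/asboolP => a b P Q h.
  by rewrite !fctZE (hf a b)//; ring.
Qed.

Lemma quadratic_submod : subsemimod_closed quadratic_pred.
Proof.
split; [split|].
- by apply/asboolP => a b P Q _; rewrite !fct0E !mulr0 !addr0.
- move=> f g /asboolP hf /asboolP hg; apply/asboolP => a b P Q h.
  by rewrite !fctDE (hf a b)// (hg a b)//; ring.
- move=> k f /asboolP hf; apply/asboolP => a b P Q h.
  by rewrite !fctZE (hf a b)//; ring.
Qed.

HB.instance Definition _ :=
  GRing.isSubmodClosed.Build R (A -> R^o) affine_pred affine_submod.
HB.instance Definition _ :=
  GRing.isSubmodClosed.Build R (A -> R^o) quadratic_pred quadratic_submod.
End Functions.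

Section Spaces.
Context {R : realType} {V : lmodType R} (A : affineType V).

Record Aff := MkAff { aff_fun :> A -> R^o; _ : aff_fun \in affine_pred }.
HB.instance Definition _ := [isSub for aff_fun].
HB.instance Definition _ := [Choice of Aff by <:].
HB.instance Definition _ := [SubChoice_isSubLmodule of Aff by <:].

Record Quad := MkQuad { quad_fun :> A -> R^o; _ : quad_fun \in quadratic_pred }.
HB.instance Definition _ := [isSub for quad_fun].
HB.instance Definition _ := [Choice of Quad by <:].
HB.instance Definition _ := [SubChoice_isSubLmodule of Quad by <:].

Lemma affP (s : Aff) : is_affine s.
Proof. by case: s => f /= /asboolP. Qed.

Lemma quadP (q : Quad) : is_quadratic q.
Proof. by case: q => f /= /asboolP. Qed.

Lemma Aff_eq (s t : Aff) : (forall P, s P = t P) -> s = t.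
Proof. by move=> e; apply/val_inj/funext. Qed.

Lemma Quad_eq (s t : Quad) : (forall P, s P = t P) -> s = t.
Proof. by move=> e; apply/val_inj/funext. Qed.

Lemma affDE (s t : Aff) P : (s + t) P = s P + t P :> R. Proof. by []. Qed.
Lemma affZE k (s : Aff) P : (k *: s) P = k * s P :> R. Proof. by []. Qed.
Lemma affNE (s : Aff) P : (- s) P = - s P :> R. Proof. by []. Qed.
Definition affE := (affDE, affZE, affNE).

Lemma quadDE (s t : Quad) P : (s + t) P = s P + t P :> R. Proof. by []. Qed.
Lemma quadZE k (s : Quad) P : (k *: s) P = k * s P :> R. Proof. by []. Qed.
Lemma quadNE (s : Quad) P : (- s) P = - s P :> R. Proof. by []. Qed.
Definition quadE := (quadDE, quadZE, quadNE).

Lemma aff_quad_subproof (s : Aff) : (s : A -> R^o) \in quadratic_pred.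
Proof.
apply/asboolP => a b P Q ab.
have h : 2^-1 + 2^-1 = 1 :> R by field.
rewrite (affP s P Q ab) (affP s P Q h).
have -> : a = 1 - b by rewrite -ab addrK.
by field.
Qed.

Definition aff_quad (s : Aff) : Quad := MkQuad (aff_quad_subproof s).

Lemma aff_one_subproof : (fun=> 1 : R^o) \in @affine_pred R V A.
Proof. by apply/asboolP => a b P Q; rewrite !mulr1. Qed.

(* u *)
Definition aff_one : Aff := MkAff aff_one_subproof.

Definition quad_affine : {pred Quad} := fun q => (q : A -> R^o) \in affine_pred.

Lemma quad_affine_zmod : zmod_closed quad_affine.
Proof.
split; first by rewrite /quad_affine/in_mem/=; exact: rpred0.
by move=> p q hp hq; exact: (rpredB hp hq).
Qed.

HB.instance Definition _ := GRing.isZmodClosed.Build Quad quad_affine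
  quad_affine_zmod.

Definition Met := {ideal_quot quad_affine}.

Record QuadM (m : Met) := MkQuadM {
  quadm_quad :> Quad;
  quadm_class : \pi_Met quadm_quad = m }.

End Spaces.

Definition mk_scalar_fun (R : comNzRingType) (U : lmodType R) (f : U -> R)
  (hf : scalar f) : U -> R := f.
HB.instance Definition _ (R : comNzRingType) (U : lmodType R) (f : U -> R)
  (hf : scalar f) := GRing.isLinear.Build R U R *%R (mk_scalar_fun hf) hf.
Definition mk_scalar (R : comNzRingType) (U : lmodType R) (f : U -> R)
  (hf : scalar f) : {scalar U} := mk_scalar_fun hf.

Definition mk_biscalar_fun (R : comNzRingType) (U : lmodType R)
  (f : U -> U -> R) (hf : bilinear_for *%R *%R f) : U -> U -> R := f.
HB.instance Definition _ (R : comNzRingType) (U : lmodType R)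
    (f : U -> U -> R) (hf : bilinear_for *%R *%R f) :=
  bilinear_isBilinear.Build R U U R *%R *%R (mk_biscalar_fun hf) hf.
Definition mk_biscalar (R : comNzRingType) (U : lmodType R)
  (f : U -> U -> R) (hf : bilinear_for *%R *%R f) : {biscalar U} :=
  mk_biscalar_fun hf.

Section Forms.
Context {R : comNzRingType} {U : lmodType R}.

Definition symmetric_bilinear (F : {biscalar U}) := forall x y, F x y = F y x.

Lemma form_combl (F : {biscalar U}) a b x y z :
  F (a *: x + b *: y) z = a * F x z + b * F y z.
Proof. by rewrite linearDl linearZl_LR (linearZl_LR F). Qed.

Lemma form_lin (F : {biscalar U}) a x y z : F (a *: x + y) z = a * F x z + F y z.
Proof. by rewrite -[y in LHS]scale1r form_combl mul1r. Qed.

Lemma form_combr (F : {biscalar U}) a b x y z :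
  F z (a *: x + b *: y) = a * F z x + b * F z y.
Proof. by rewrite linearDr linearZr_LR (linearZr_LR F). Qed.

Lemma form_comb_sq (F : {biscalar U}) a b x y : symmetric_bilinear F ->
  F (a *: x + b *: y) (a *: x + b *: y)
  = a * a * F x x + (1 + 1) * (a * b) * F x y + b * b * F y y.
Proof. by move=> FC; rewrite form_combl !form_combr (FC y x); ring. Qed.

Lemma scalar_lin (f : {scalar U}) a x y : f (a *: x + y) = a * f x + f y.
Proof. exact: linearP. Qed.

Lemma scalar_comb (f : {scalar U}) a b x y :
  f (a *: x + b *: y) = a * f x + b * f y.
Proof. by rewrite linearD !linearZ_LR. Qed.

Definition trivial_nullspace (F : {biscalar U}) :=
  forall x, (forall y, F x y = 0) -> x = 0.

Definition form_map (F : {biscalar U}) (x : U) : {scalar U} := F x.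

(* The inverse form, on the dual of U: when form_map F is bijective, xget
   selects the unique preimage of a. *)
Definition form_inv (F : {biscalar U}) (a b : {scalar U}) : R :=
  b (xget 0 [set x | form_map F x = a]%classic).

End Forms.

Section QuadraticLine.
Context {R : realType} {V : lmodType R} {A : affineType V}.
Variables (f : A -> R) (fq : is_quadratic f) (O : A).

Let F x := f (trans O x).

Let FE a b x y : a + b = 1 -> F (a *: x + b *: y) =
  a * (a - b) * F x + b * (b - a) * F y + 4 * a * b * F (2^-1 *: (x + y)).
Proof.
move=> ab; have e t z w : bary t (trans O z) (trans O w)
    = trans O ((1 - t) *: z + t *: w).
  by rewrite -(trans_vec O (bary _ _ _)) vec_bary !vec_trans.
have := @fq a b (trans O x) (trans O y) ab; rewrite !e.
have -> : 1 - b = a by rewrite -ab addrK.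
have -> : 1 - 2^-1 = 2^-1 :> R by field.
by rewrite -scalerDr.
Qed.

Let N x := F (- x).
Let G x := F x + N x - 2 * F 0.
Let L x := F x - N x.

Let F_line a x : F (a *: x) = F 0 + a * (L x / 2) + a ^+ 2 * (G x / 2).
Proof.
have := @FE ((1 + a) / 2) ((1 - a) / 2) x (- x).
rewrite scalerN -scaleNr -scalerDl.
have -> : (1 + a) / 2 + - ((1 - a) / 2) = a by field.
rewrite subrr scaler0 => ->; last by field.
by rewrite /L /G /N; field.
Qed.

Let G0 : G 0 = 0. Proof. by rewrite /G /N oppr0; ring. Qed.
Let L0 : L 0 = 0. Proof. by rewrite /L /N oppr0; ring. Qed.

Let LZ a x : L (a *: x) = a * L x.
Proof. by rewrite {1}/L /N -scaleNr !F_line; field. Qed.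

Let GZ a x : G (a *: x) = a ^+ 2 * G x.
Proof. by rewrite {1}/G /N -scaleNr !F_line; field. Qed.

Let NE a b x y : a + b = 1 -> N (a *: x + b *: y) =
  a * (a - b) * N x + b * (b - a) * N y + 4 * a * b * N (2^-1 *: (x + y)).
Proof.
move=> ab; rewrite /N opprD -!scalerN (FE _ _ ab).
by rewrite -[- x + - y]opprD.
Qed.

Let GE a b x y : a + b = 1 -> G (a *: x + b *: y) =
  a * (a - b) * G x + b * (b - a) * G y + a * b * G (x + y).
Proof.
move=> ab; have -> : G (x + y) = 4 * G (2^-1 *: (x + y)) by rewrite GZ; field.
rewrite /G (FE _ _ ab) (NE _ _ ab).
have -> : a = 1 - b by rewrite -ab addrK.
by ring.
Qed.

Let LE a b x y : a + b = 1 -> L (a *: x + b *: y) =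
  a * (a - b) * L x + b * (b - a) * L y + 2 * a * b * L (x + y).
Proof.
move=> ab; have -> : L (x + y) = 2 * L (2^-1 *: (x + y)) by rewrite LZ; field.
rewrite /L (FE _ _ ab) (NE _ _ ab).
have -> : a = 1 - b by rewrite -ab addrK.
by ring.
Qed.

Let S x y := L (x + y) - L x - L y.

Let SZ a b x y : a + b != 0 -> S (a *: x) (b *: y) = 2 * a * b / (a + b) * S x y.
Proof.
move=> ab; rewrite /S !LZ.
have -> : a *: x + b *: y
    = (a + b) *: (a / (a + b) *: x + b / (a + b) *: y).
  by rewrite scalerDr !scalerA !(mulrCA (a + b)) mulfV// !mulr1.
rewrite LZ LE; last by rewrite -mulrDl mulfV.
by field.
Qed.

Let LD x y : L (x + y) = L x + L y.
Proof.
have h2 : (2 + 1 != 0 :> R) by rewrite -(natrD _ 2 1) pnatr_eq0.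
have h4 : (4 + 1 != 0 :> R) by rewrite -(natrD _ 4 1) pnatr_eq0.
have e1 := @SZ 2 1 x y h2; have e2 := @SZ 2 1 (2 *: x) y h2.
have e4 := @SZ 4 1 x y h4.
rewrite scalerA !scale1r in e1 e2 e4.
have e : (2 * 2 = 4 :> R) by ring.
rewrite e e1 e4 in e2.
have c1 : 2 * 2 * 1 / (2 + 1) = 4 / 3 :> R by field.
have c2 : 2 * 4 * 1 / (4 + 1) = 8 / 5 :> R by field.
have c3 : 4 * 1 / (2 + 1) = 4 / 3 :> R by field.
have : S x y = 0 by rewrite c1 c2 c3 in e2; lra.
by rewrite /S; lra.
Qed.

Let T x y := G (x + y) - G x - G y.

Let TZ a b x y : a + b != 0 -> T (a *: x) (b *: y) = a * b * T x y.
Proof.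
move=> ab; rewrite /T !GZ.
have -> : a *: x + b *: y
    = (a + b) *: (a / (a + b) *: x + b / (a + b) *: y).
  by rewrite scalerDr !scalerA !(mulrCA (a + b)) mulfV// !mulr1.
rewrite GZ GE; last by rewrite -mulrDl mulfV.
by field.
Qed.

Let TZl a x y : T (a *: x) y = a * T x y.
Proof.
have [a1|a1] := eqVneq (a + 1) 0; last first.
  by rewrite -{1}(scale1r y) TZ// mulr1.
have -> : a = 2 * -(2^-1) by lra.
have e b z w : b + 1 != 0 -> T (b *: z) w = b * T z w.
  by move=> h; rewrite -{1}(scale1r w) TZ// mulr1.
rewrite -scalerA e; last by rewrite -(natrD _ 2 1) pnatr_eq0.
rewrite e ?mulrA//.
have -> : - 2^-1 + 1 = 2^-1 :> R by field.
by rewrite invr_eq0 pnatr_eq0.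
Qed.

Let parallelogram x y : G (x + y) + G (x - y) = 2 * G x + 2 * G y.
Proof.
have := TZl (-1) y x; rewrite /T scaleN1r.
have := GZ (-1) y; rewrite scaleN1r.
by rewrite (addrC (- y) x) (addrC y x); lra.
Qed.

Let TDl x y z : T (x + y) z = T x z + T y z.
Proof.
rewrite /T.
have p1 := parallelogram (x + z) y; have p2 := parallelogram x (y - z).
have p3 := parallelogram (x + y) z; have p4 := parallelogram y z.
have e1 : x + z + y = x + y + z by rewrite addrAC.
have e2 : x + z - y = x - (y - z) by rewrite opprB addrA.
have e3 : x + (y - z) = x + y - z by rewrite addrA.
by rewrite e1 e2 in p1; rewrite e3 in p2; lra.
Qed.

Let TC x y : T x y = T y x.
Proof. by rewrite /T (addrC x y); ring. Qed.

Lemma quadratic_expansion : exists g : {biscalar V}, exists l : {scalar V},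
  symmetric_bilinear g /\
  forall x, f (trans O x) = f O + l x + 2^-1 * g x x.
Proof.
have Tlin : bilinear_for *%R *%R (fun x y => 2^-1 * T x y).
  split=> [u' a x y|u a x y]; first by rewrite /= TDl TZl; ring.
  by rewrite /= (TC u) TDl TZl (TC x u) (TC y u); ring.
have Llin : scalar (fun x => 2^-1 * L x).
  by move=> a x y; rewrite /= LD LZ; ring.
exists (mk_biscalar Tlin), (mk_scalar Llin); split=> [x y|x].
  by rewrite /mk_biscalar/= /mk_biscalar_fun TC.
rewrite /mk_biscalar/= /mk_biscalar_fun /mk_scalar/= /mk_scalar_fun.
have := F_line 1 x; rewrite scale1r {1 2}/F trans0 => ->.
rewrite /T; have := GZ 2 x; rewrite scaler_nat mulr2n => ->.
by field.
Qed.

End QuadraticLine.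

Section Hessian.
Context {R : realType} {V : lmodType R} {A : affineType V}.
Implicit Types (q : Quad A) (g : {biscalar V}).

Lemma vec_inj (O P Q : A) : vec O P = vec O Q -> P = Q.
Proof. by move=> e; rewrite -(trans_vec O P) e trans_vec. Qed.

(* bary (-1) P Q is the point 2 P - Q *)
Definition is_hess q g := symmetric_bilinear g /\
  forall P Q, 2^-1 * (q Q + q (bary (-1) P Q)) - q P
              = 2^-1 * g (vec P Q) (vec P Q).

Lemma hess_exists q : exists g, is_hess q g.
Proof.
have [O] := @affine_inhabited _ _ A.
have [g [l [gC qE]]] := quadratic_expansion (@quadP _ _ _ q) O.
exists g; split=> // P Q.
have [c E] : exists c : R, forall X,
    q X = c + l (vec O X) + 2^-1 * g (vec O X) (vec O X) :> R.
  by exists (q O) => X; rewrite -{1}(trans_vec O X) qE.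
rewrite !E (vec_via O P Q) vec_bary !form_comb_sq// scalar_comb.
by field.
Qed.

Lemma hess_unique q g g' : is_hess q g -> is_hess q g' -> g = g'.
Proof.
move=> [gC gE] [gC' gE']; have [O] := @affine_inhabited _ _ A.
have d x : g x x = g' x x.
  have := gE O (trans O x); rewrite gE' vec_trans => e.
  by apply: (@mulfI _ (2^-1 : R)); rewrite ?invr_eq0 ?pnatr_eq0.
apply: biscalarP => x y; have := d (x + y).
rewrite -{1 2 3 4}(scale1r x) -{1 2 3 4}(scale1r y) !form_comb_sq// !d.
by lra.
Qed.

Definition hess q : {biscalar V} := sval (cid (hess_exists q)).

Lemma hessP q : is_hess q (hess q).
Proof. exact: svalP (cid (hess_exists q)). Qed.

Lemma same_hess_affine q q' g : is_hess q g -> is_hess q' g ->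
  q - q' \in quad_affine (A := A).
Proof.
move=> [_ e] [_ e']; apply/asboolP => a b P Q ab.
have h (d : Quad A) : d = q - q' ->
    d (bary 2^-1 P Q) = 2^-1 * (d P + d Q) :> R.
  move=> ->; set M := bary _ _ _.
  have -> : Q = bary (-1) M P.
    apply: (@vec_inj P); rewrite !vec_bary !vecPP !scaler0 !addr0 add0r scalerA.
    rewrite opprK (_ : (1 + 1) * 2^-1 = 1 :> R) ?scale1r//; by field.
  by have := e M P; have := e' M P; rewrite !quadE; lra.
rewrite (quadP (q - q') P Q ab) h//.
have -> : a = 1 - b by rewrite -ab addrK.
by field.
Qed.

(* By hess_quadm, the choice of a representative of m is irrelevant. *)
Definition hess_met (m : Met A) : {biscalar V} := hess (repr m).

Lemma same_class_hess q q' : q - q' \in quad_affine (A := A) ->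
  hess q = hess q'.
Proof.
move=> /asboolP h; apply: (@hess_unique q); first exact: hessP.
have [gC gE] := hessP q'; split=> // P Q; rewrite -gE.
have := h (1 + 1) (-1) P Q; rewrite addrK => /(_ erefl).
by rewrite !quadE; lra.
Qed.

Lemma hess_quadm (m : Met A) (q : QuadM m) : hess q = hess_met m.
Proof.
apply: same_class_hess; rewrite Quotient.idealrBE; apply/eqP.
by rewrite reprK quadm_class.
Qed.

Definition nondegenerate_metric (m : Met A) := trivial_nullspace (hess_met m).

Lemma hess_met_sym (m : Met A) : symmetric_bilinear (hess_met m).
Proof. exact: (hessP _).1. Qed.

Definition half_square g (P Q : A) : R^o := 2^-1 * g (vec P Q) (vec P Q).

Lemma half_square_quadratic g P : symmetric_bilinear g ->
  half_square g P \in quadratic_pred.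
Proof.
move=> gC; apply/asboolP => a b X Y ab; rewrite /half_square !vec_bary.
rewrite !form_comb_sq//.
have -> : a = 1 - b by rewrite -ab addrK.
by field.
Qed.

Lemma half_square_hess g P (gC : symmetric_bilinear g) :
  is_hess (MkQuad (half_square_quadratic P gC)) g.
Proof.
split=> // X Y /=; rewrite /half_square (vec_via P X Y) vec_bary.
by rewrite !form_comb_sq//; field.
Qed.

Lemma half_square_class (m : Met A) P :
  \pi_(Met A) (MkQuad (half_square_quadratic P (hess_met_sym m))) = m.
Proof.
rewrite -[m in RHS]reprK; apply/eqP; rewrite -Quotient.idealrBE.
apply: (@same_hess_affine _ _ (hess_met m)); last exact: hessP.
exact: half_square_hess.
Qed.

(* delta^m : A -> Quad_m A *)
Definition cm_map (m : Met A) (P : A) : QuadM m :=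
  MkQuadM (half_square_class m P).

End Hessian.

Section QuadMAffine.
Context {R : realType} {V : lmodType R} {A : affineType V} (m : Met A).
Implicit Types (q : QuadM m) (s : Aff A).

Lemma quadm_eq q q' : (forall P, q P = q' P) -> q = q'.
Proof.
case: q q' => [q e] [q' e'] /= /Quad_eq h; case: _ / h e' => e'.
by rewrite (Prop_irrelevance e e').
Qed.

Lemma quadm_trans_subproof q s : \pi_(Met A) (quadm_quad q + aff_quad s) = m.
Proof.
rewrite -[RHS](quadm_class q); apply/eqP; rewrite -Quotient.idealrBE.
rewrite addrC addKr /quad_affine; apply/asboolP; exact: affP.
Qed.

Definition quadm_trans q s : QuadM m := MkQuadM (quadm_trans_subproof q s).

Lemma quadm_vec_subproof q q' :
  ((quadm_quad q' - quadm_quad q : Quad A) : A -> R^o) \in affine_pred.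
Proof.
suff : (quadm_quad q' - quadm_quad q) \in quad_affine (A := A) by [].
by rewrite Quotient.idealrBE; apply/eqP; rewrite !quadm_class.
Qed.

Definition quadm_vec q q' : Aff A := MkAff (quadm_vec_subproof q q').

Lemma quadm_inhabited : inhabited (QuadM m).
Proof. by constructor; exists (repr m); exact: reprK. Qed.

Lemma quadm_trans_vec q q' : quadm_trans q (quadm_vec q q') = q'.
Proof. apply: quadm_eq => P; change (q P + (q' P - q P) = q' P).
by rewrite addrC subrK. Qed.

Lemma quadm_vec_trans q s : quadm_vec q (quadm_trans q s) = s.
Proof. apply: Aff_eq => P; change (q P + s P - q P = s P).
by rewrite (addrC (q P)) addrK. Qed.

Lemma quadm_transD q s t :
  quadm_trans q (s + t) = quadm_trans (quadm_trans q s) t.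
Proof. apply: quadm_eq => P; change (q P + (s P + t P) = q P + s P + t P).
by rewrite addrA. Qed.

HB.instance Definition _ := isAffine.Build R (Aff A) (QuadM m)
  quadm_inhabited quadm_trans_vec quadm_vec_trans quadm_transD.

End QuadMAffine.

Section AffineDifferences.
Context {R : realType} {V : lmodType R} {A : affineType V}.
Implicit Types (s : Aff A) (P Q : A) (x y : V).

Lemma bary_trans b P x y :
  bary b (trans P x) (trans P y) = trans P ((1 - b) *: x + b *: y).
Proof. by apply: (@vec_inj _ _ _ P); rewrite vec_bary !vec_trans. Qed.

Lemma aff_diffZ s P a x : s (trans P (a *: x)) - s P = a * (s (trans P x) - s P).
Proof.
have ab : (1 - a) + a = 1 by rewrite subrK.
have := affP s P (trans P x) ab.
rewrite -{1}(trans0 P) bary_trans scaler0 add0r => ->.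
by ring.
Qed.

Lemma aff_diffD s P x y : s (trans P (x + y)) - s P
  = (s (trans P x) - s P) + (s (trans P y) - s P).
Proof.
have h : 2^-1 + 2^-1 = 1 :> R by field.
have := affP s (trans P (2 *: x)) (trans P (2 *: y)) h.
have e : 1 - 2^-1 = 2^-1 :> R by field.
rewrite bary_trans e !scalerA mulVf ?pnatr_eq0// !scale1r => ->.
have := aff_diffZ s P 2 x; have := aff_diffZ s P 2 y.
by set a := s _; set b := s _; set c := s _; set d := s _; lra.
Qed.

Lemma aff_diff s P Q x : s (trans P x) - s P = s (trans Q x) - s Q.
Proof.
rewrite -{1 2}(trans_vec Q P) -transD.
by have := aff_diffD s Q (vec Q P) x; lra.
Qed.

Lemma aff_diff_linear P Q :
  scalar (fun s => s Q - s P).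
Proof.
move=> a s t.
change (a * s Q + t Q - (a * s P + t P) = a * (s Q - s P) + (t Q - t P) :> R).
by ring.
Qed.

End AffineDifferences.

(* The linear hull of A, dual to Aff A. *)
Definition hull (R : realType) (V : lmodType R) (A : affineType V) :=
  {scalar Aff A}.

Section Hull.
Context {R : realType} {V : lmodType R} {A : affineType V}.
Implicit Types (s : Aff A) (P Q : A) (x y : V).

Lemma ev_scalar P : scalar (fun s => s P : R).
Proof. by []. Qed.

(* z_P *)
Definition ev P : hull A := mk_scalar (ev_scalar P).

Definition origin : A := sval (cid (let: inhabits P := @affine_inhabited R V A
  in ex_intro (fun=> True) P I)).

(* The embedding of the director space, x |-> z_Q - z_P for any P, Q with
   vec P Q = x (see vec_hullE). *)
Definition vec_hull x : hull A :=
  mk_scalar (aff_diff_linear origin (trans origin x)).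

Lemma vec_hullE P Q s : vec_hull (vec P Q) s = s Q - s P.
Proof. by rewrite -{2}(trans_vec P Q); exact: aff_diff. Qed.

End Hull.

Section CayleyMenger.
Context {R : realType} {V : lmodType R} {A : affineType V} (m : Met A).
Implicit Types (v w : Aff (QuadM m)) (P : A) (q : QuadM m) (s : Aff A).

Lemma vP_affine P : (fun q => q P) \in @affine_pred R (Aff A) (QuadM m).
Proof.
apply/asboolP => a b q q' ab.
change (q P + b * (q' P - q P) = a * q P + b * q' P :> R).
have -> : a = 1 - b by rewrite -ab addrK.
by ring.
Qed.

(* v_P *)
Definition vP P : Aff (QuadM m) := MkAff (vP_affine P).

Lemma dm_scalar v :
  scalar (fun s => v (trans (origin : QuadM m) s) - v (origin : QuadM m) : R).
Proof.
by move=> a s t; rewrite /= aff_diffD aff_diffZ.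
Qed.

(* d_m v; dmE shows that the base point is irrelevant. *)
Definition dm v : hull A := mk_scalar (dm_scalar v).

Lemma dmE v q s : dm v s = v (trans q s) - v q.
Proof. exact: aff_diff. Qed.

Lemma um_scalar : scalar (fun v => dm v (aff_one A)).
Proof. exact: aff_diff_linear. Qed.

(* u_m *)
Definition um : hull (QuadM m) := mk_scalar um_scalar.

(* When um v = 0, dm v lies in {z : <z, u> = 0}, which vec_hull identifies with
   the director space: x1 and x2 are dm v1 and dm v2 as vectors. *)
Definition is_CM (F : {biscalar Aff (QuadM m)}) := [/\
  symmetric_bilinear F,
  forall v1 v2 x1 x2, um v1 = 0 -> um v2 = 0 ->
    dm v1 = vec_hull x1 -> dm v2 = vec_hull x2 ->
    F v1 v2 = - hess_met m x1 x2 &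
  forall P, form_map F (vP P) = ev (cm_map m P)].

End CayleyMenger.

Section CayleyMengerFinite.
Context {R : realType} {V : vectType R} {A : affineType V}.

(* In finite dimension the director space is the whole of {z : <z, u> = 0},
   so that the condition on Aff_0 in is_CM is never vacuous. *)
Lemma vec_hull_surj (z : hull A) : z (aff_one A) = 0 ->
  exists x : V, z = vec_hull x.
Proof.
move=> z0; pose O : A := origin; pose b := vbasis {: V}.
have co_affine i :
    (fun P => coord b i (vec O P) : R) \in @affine_pred R V A.
  apply/asboolP => c d P Q cd; rewrite vec_bary linearD !linearZ/=.
  by rewrite -cd addrK.
pose co i : Aff A := MkAff (co_affine i).
exists (\sum_(i < \dim {: V}) z (co i) *: b`_i).
apply: scalarP => s.
have lin : scalar (fun x => s (trans O x) - s O : R).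
  by move=> a x y; rewrite /= aff_diffD aff_diffZ.
have linE x : mk_scalar lin x = s (trans O x) - s O by [].
have sE : s = s O *: aff_one A + \sum_(i < \dim {: V}) mk_scalar lin b`_i *: co i.
  apply: Aff_eq => P; rewrite affDE affZE.
  have -> : (\sum_(i < \dim {: V}) mk_scalar lin b`_i *: co i) P
      = \sum_(i < \dim {: V}) mk_scalar lin b`_i * coord b i (vec O P) :> R.
    by rewrite -[LHS]/(ev P _) linear_sum.
  have -> : \sum_(i < \dim {: V}) mk_scalar lin b`_i * coord b i (vec O P) = s P - s O.
    rewrite -[in RHS](trans_vec O P) -linE.
    rewrite [in RHS](coord_vbasis (memvf (vec O P))) linear_sum.
    by apply: eq_bigr => i _; rewrite linearZ_LR/= mulrC.
  by rewrite -[aff_one A P]/(1 : R) mulr1 addrC subrK.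
rewrite [in LHS]sE linearD linearZ_LR z0 mulr0 add0r linear_sum.
rewrite -[RHS]/(mk_scalar lin _) linear_sum.
by apply: eq_bigr => i _; rewrite !linearZ_LR/= mulrC.
Qed.

Lemma coord_affine O i : (fun P : A => coord (vbasis {: V}) i (vec O P) : R)
  \in @affine_pred R V A.
Proof.
apply/asboolP => c d P Q cd; rewrite vec_bary linearD !linearZ/=.
by rewrite -cd addrK.
Qed.

Lemma vec_hull_inj : injective (@vec_hull R V A).
Proof.
move=> x y e; rewrite (coord_vbasis (memvf x)) (coord_vbasis (memvf y)).
apply: eq_bigr => i _; congr (_ *: _).
pose O : A := origin; pose c : Aff A := MkAff (coord_affine O i).
have h z : vec_hull z c = coord (vbasis {: V}) i z :> R.
  rewrite -[z in LHS](vec_trans O z) vec_hullE.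
  rewrite -[c _]/(coord _ i (vec O (trans O z))) -[c _]/(coord _ i (vec O O)).
  by rewrite vec_trans vecPP linear0 subr0.
by rewrite -!h e.
Qed.

Variable m : Met A.
Implicit Types (v w : Aff (QuadM m)) (P : A) (s : Aff A).

Let O : A := origin.

Lemma um_vP P : um m (vP m P) = 1.
Proof.
rewrite -[LHS]/(dm _ (aff_one A)) (dmE _ origin).
change (origin (A := QuadM m) P + 1 - origin (A := QuadM m) P = 1 :> R).
by rewrite addrC addKr.
Qed.

Lemma dm_vP P s : dm (vP m P) s = s P.
Proof.
rewrite (dmE _ origin).
change (origin (A := QuadM m) P + s P - origin (A := QuadM m) P = s P :> R).
by rewrite addrC addKr.
Qed.

Let dm_lin a v w s : dm (a *: v + w) s = a * dm v s + dm w s.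
Proof.
rewrite !(dmE _ origin) !affDE !affZE.
by set b := v _; set c := v _; set d := w _; set e := w _; ring.
Qed.

Let dm0_scalar v : scalar (fun s => dm v s - um m v * s O : R).
Proof.
move=> a s t.
change (dm v (a *: s + t) - um m v * (a * s O + t O)
  = a * (dm v s - um m v * s O) + (dm v t - um m v * t O)).
by rewrite scalar_lin; ring.
Qed.

Let dm_dec v : exists x, mk_scalar (dm0_scalar v) = vec_hull x.
Proof.
apply: vec_hull_surj.
by change (dm v (aff_one A) - um m v * 1 = 0); rewrite mulr1 subrr.
Qed.

Let X v : V := sval (cid (dm_dec v)).

Let XE v s : dm v s = um m v * s O + vec_hull (X v) s.
Proof.
rewrite -[vec_hull _](svalP (cid (dm_dec v))).
by change (dm v s = um m v * s O + (dm v s - um m v * s O)); rewrite subrKC.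
Qed.

Let X_eq v x : (forall s, dm v s = um m v * s O + vec_hull x s) -> X v = x.
Proof.
move=> e; apply: vec_hull_inj; apply: scalarP => s.
by apply: (addrI (um m v * s O)); rewrite -XE e.
Qed.

Let vec_hull_linear a x y s :
  vec_hull (A := A) (a *: x + y) s = a * vec_hull x s + vec_hull y s.
Proof. by rewrite -[LHS]/(s _ - s _) aff_diffD aff_diffZ. Qed.

Let X_linear a v w : X (a *: v + w) = a *: X v + X w.
Proof.
apply: X_eq => s; rewrite vec_hull_linear scalar_lin.
rewrite -[LHS]/(dm _ _) dm_lin !XE; ring.
Qed.

Let g := hess_met m.
Let dO : QuadM m := cm_map m O.

Let cm_shift P w : w (cm_map m P)
  = w dO + um m w * (2^-1 * g (vec O P) (vec O P)) - g (vec O P) (X w).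
Proof.
have gC : symmetric_bilinear g := hess_met_sym m.
have := XE w (vec dO (cm_map m P)); rewrite (dmE _ dO) trans_vec.
rewrite -[vec_hull _ _]/(_ - _).
set p := vec O P; set x := X w.
have tE Q : (vec dO (cm_map m P) : Aff A) Q
    = 2^-1 * g p p - g p (vec O Q) :> R.
  change (2^-1 * g (vec P Q) (vec P Q) - 2^-1 * g (vec O Q) (vec O Q)
    = 2^-1 * g p p - g p (vec O Q)).
  by rewrite (vec_via O P Q) form_comb_sq//; field.
rewrite !tE vecPP vec_trans linear0r.
by set a := w _; set b := w _; set c := g _ _; set d := g _ _; lra.
Qed.

Lemma CM_exists : exists F, @is_CM R V A m F.
Proof.
pose f v w : R := um m v * w dO + um m w * v dO - g (X v) (X w).
have gC : symmetric_bilinear g := hess_met_sym m.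
have fC v w : f v w = f w v by rewrite /f (gC (X v)); ring.
have fl w a v v' : f (a *: v + v') w = a * f v w + f v' w.
  rewrite /f X_linear scalar_lin affDE affZE form_lin.
  by ring.
have fB : bilinear_for *%R *%R f.
  by split=> [w a v v'|w a v v'] //; rewrite /= fC fl !(fC w).
exists (mk_biscalar fB); split=> // [v1 v2 x1 x2 u1 u2 e1 e2|P].
  rewrite -[LHS]/(f v1 v2) /f u1 u2.
  have -> : X v1 = x1 by apply: X_eq => s; rewrite u1 e1 mul0r add0r.
  have -> : X v2 = x2 by apply: X_eq => s; rewrite u2 e2 mul0r add0r.
  by rewrite !mul0r !add0r.
apply: scalarP => w; rewrite -[LHS]/(f _ w) -[RHS]/(w (cm_map m P)) cm_shift.
rewrite /f um_vP.
have -> : X (vP m P) = vec O P.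
  by apply: X_eq => s; rewrite dm_vP um_vP vec_hullE mul1r subrKC.
by rewrite -[vP m P dO]/(2^-1 * g (vec O P) (vec O P)); ring.
Qed.

Lemma CM_unique F F' : @is_CM R V A m F -> is_CM F' -> F = F'.
Proof.
move=> [FC F0 FP] [FC' F0' FP']; apply: biscalarP.
have FO P w : F (vP m P) w = F' (vP m P) w.
  by rewrite -[LHS]/(form_map F _ w) -[RHS]/(form_map F' _ w) FP FP'.
pose d v := v - um m v *: vP m O.
have ud v : um m (d v) = 0.
  by rewrite /d addrC -scaleNr scalar_lin um_vP mulr1 addNr.
have dE v : v = um m v *: vP m O + 1 *: d v by rewrite scale1r subrKC.
have xd v : dm (d v) = vec_hull (X (d v)).
  by apply: scalarP => s; rewrite XE ud mul0r add0r.
move=> v w; rewrite (dE v) !form_combl FO; congr (_ + 1 * _).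
rewrite (dE w) !form_combr; congr (_ * _ + 1 * _).
  by rewrite FC FC' FO.
by rewrite (F0 _ _ _ _ (ud v) (ud w) (xd v) (xd w))
  (F0' _ _ _ _ (ud v) (ud w) (xd v) (xd w)).
Qed.

Definition CM : {biscalar Aff (QuadM m)} := sval (cid CM_exists).

Lemma CMP : is_CM CM.
Proof. exact: svalP (cid CM_exists). Qed.

End CayleyMengerFinite.

(* Main.v *)
Require Import Defs.
From HB Require Import structures.
From mathcomp Require Import all_boot all_order all_algebra.
From mathcomp Require Import lra.
From mathcomp Require Import boolp classical_sets functions reals.
Import Order.TTheory GRing.Theory Num.Theory.
Set Implicit Arguments.
Unset Strict Implicit.
Unset Printing Implicit Defensive.
Local Open Scope ring_scope.

(** The space of affine functionals on Quad_m A is the direct sum of the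
    constants, of the line of some v_O, and of the functionals that vanish at
    delta_O and whose differential is a vector x of the director space. In this
    decomposition CM_m is the orthogonal sum of a hyperbolic plane, spanned by
    the isotropic vectors 1 and v_O with CM_m(1, v_O) = 1, and of -g on the
    director space, where g is the hessian of m. The plane comes from
    CM_m(1) = u_m ([CM_one]) and CM_m(v_O) = delta_O ([CM_vP]). Hence CM_m is
    invertible because g is non-degenerate ([CM_inj] and [CM_surj]).

    Since dm v_P = z_P, the functional v_P determines P, so the injectivity of
    CM_m gives that of P |-> delta_P = CM_m(v_P).

    For the description of the image, write a point of the hull as CM_m(v). The
    two equations become CM_m(v, v) = 0 and u_m(v) = 1. The second one says that
    dm v lies in A, so that v = v_P + c 1 for a point P and a constant c
    ([um1_vP]); as v_P and 1 are isotropic with product 1, the first one then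
    reads 2 c = 0, that is v = v_P. *)

(** * Non-degenerate forms and their inverses *)

(** In the coordinates of a basis, [F] is an endomorphism of [V]; it is injective
    because [F] is non-degenerate, hence surjective. *)
Lemma trivial_nullspace_represents (K : fieldType) (V : vectType K)
    (F : {biscalar V}) : trivial_nullspace F ->
  forall l : {scalar V}, exists x, forall y, F x y = l y.
Proof.
move=> F0 l; pose b := vbasis {: V}.
pose phi x := \sum_(i < \dim {: V}) F x b`_i *: b`_i.
have lin : linear phi.
  move=> a x y; rewrite scaler_sumr -big_split; apply: eq_bigr => i _.
  by rewrite form_lin scalerDl scalerA.
pose f : {linear V -> V} := HB.pack phi (GRing.isLinear.Build _ _ _ _ phi lin).
have fE x : linfun f x = phi x by rewrite lfunE.
have comb_inj (c d : 'I_(\dim {: V}) -> K) :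
    \sum_(i < _) c i *: b`_i = \sum_(i < _) d i *: b`_i -> c =1 d.
  move=> e i; have fb : free b by exact: basis_free (vbasisP _).
  by rewrite -(coord_sum_free c i fb) e coord_sum_free.
have basis_eq (k l' : {scalar V}) :
    (forall i : 'I_(\dim {: V}), k b`_i = l' b`_i) -> k =1 l'.
  move=> e y; rewrite (coord_vbasis (memvf y)) !linear_sum.
  by apply: eq_bigr => i _; rewrite !linearZ_LR -/b e.
have inj : lker (linfun f) == 0%VS.
  apply/lker0P => x y; rewrite !fE => /comb_inj e.
  apply/eqP; rewrite -subr_eq0; apply/eqP/F0 => z.
  rewrite linearBl; apply/eqP; rewrite subr_eq0; apply/eqP.
  exact: (basis_eq (F x) (F y)).
have [x] : exists x, linfun f x = \sum_(i < \dim {: V}) l b`_i *: b`_i.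
  exists ((linfun f)^-1%VF (\sum_(i < \dim {: V}) l b`_i *: b`_i)).
  by rewrite lker0_lfunVK.
by rewrite fE => /comb_inj e; exists x; exact: basis_eq.
Qed.

Lemma form_inv_map (K : comNzRingType) (U : lmodType K) (F : {biscalar U}) x b :
  injective (form_map F) -> form_inv F (form_map F x) b = b x.
Proof.
move=> Finj; rewrite /form_inv.
have /(xgetPex 0) : exists y, [set y | form_map F y = form_map F x]%classic y.
  by exists x.
by move=> /Finj ->.
Qed.

(** * Points in the linear hull *)

Section Points.
Context {R : realType} {V : vectType R} {A : affineType V}.

Lemma ev_trans (P : A) x (s : Aff A) :
  ev (trans P x) s = ev P s + vec_hull x s.
Proof.
rewrite -{2}(vec_trans P x) vec_hullE.
by rewrite -[ev _ s]/(s _ : R) -[ev P s]/(s P : R) addrC subrK.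
Qed.

Lemma ev_inj : injective (@ev R V A).
Proof.
move=> P Q e; apply: (@vec_inj _ _ _ P); rewrite vecPP.
apply: (@vec_hull_inj _ _ A).
apply: Defs.scalarP => s; rewrite vec_hullE -[0 in LHS](vecPP P) vec_hullE.
by rewrite -[s Q]/(ev Q s) -e.
Qed.

End Points.

(** * The Cayley-Menger form *)

Section CayleyMengerInverse.
Context {R : realType} {V : vectType R} {A : affineType V} (m : Met A).
Implicit Types (v w : Aff (QuadM m)) (P : A) (s : Aff A) (z : hull A).

Let F := CM m.
Let I := aff_one (QuadM m).

Let FC : symmetric_bilinear F. Proof. by have [] := CMP m. Qed.

Lemma hull_affine z (q : QuadM m) : (fun q' => z (vec q q')) \in affine_pred.
Proof.
apply/asboolP => a b q1 q2 ab; rewrite vec_bary scalar_comb.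
by rewrite -ab addrK.
Qed.

(** With [q] fixed, a linear section of [dm]: this lifts the vectors of the
    director space to functionals, linearly, whereas [P |-> vP m P] is only
    quadratic. *)
Definition hull_aff z q : Aff (QuadM m) := MkAff (hull_affine z q).

Lemma dm_hull_aff z q : dm (hull_aff z q) = z.
Proof.
apply: Defs.scalarP => s; rewrite (dmE _ q).
rewrite -[hull_aff z q (trans q s)]/(z (vec q (trans q s))).
by rewrite -[hull_aff z q q]/(z (vec q q)) vec_trans vecPP linear0 subr0.
Qed.

Lemma um_dm v : um m v = dm v (aff_one A).
Proof. by []. Qed.

Lemma dm_lin a v w s : dm (a *: v + w) s = a * dm v s + dm w s.
Proof.
rewrite !(dmE _ origin) !affDE !affZE.
by set b := v _; set c := v _; set d := w _; set e := w _; lra.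
Qed.

Lemma dm_eq v w q : dm v =1 dm w -> v = w + (v q - w q) *: I.
Proof.
move=> e; apply: Aff_eq => q'; rewrite affDE affZE -[I _]/(1 : R) mulr1.
have := e (vec q q'); rewrite !(dmE _ q) trans_vec.
by set a := v _; set b := v _; set c := w _; set d := w _; lra.
Qed.

Lemma dm_vec_hull0 x : vec_hull x (aff_one A) = 0.
Proof. by rewrite -[LHS]/(1 - 1 : R) subrr. Qed.

Lemma dm_one : dm I =1 (fun=> 0).
Proof. by move=> s; rewrite (dmE _ origin) subrr. Qed.

Lemma um_one : um m I = 0.
Proof. exact: dm_one. Qed.

Lemma CM_vP P w : F (vP m P) w = w (cm_map m P).
Proof. by have [_ _ /(_ P) e] := CMP m; rewrite -[LHS]/(form_map F _ w) e. Qed.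

Lemma CM_vP_isotropic P : F (vP m P) (vP m P) = 0.
Proof.
rewrite CM_vP -[LHS]/(2^-1 * hess_met m (vec P P) (vec P P)).
by rewrite vecPP linear0r mulr0.
Qed.

Lemma CM_hess v w x y : dm v = vec_hull x -> dm w = vec_hull y ->
  F v w = - hess_met m x y.
Proof.
have [_ h _] := CMP m => ev ew.
by apply: h => //; rewrite um_dm ?ev ?ew dm_vec_hull0.
Qed.

Lemma um_sub_vP w P : um m (- um m w *: vP m P + w) = 0.
Proof. by rewrite scalar_lin um_vP mulr1 addNr. Qed.

Lemma dm_sub_vP w P :
  exists x, dm (- um m w *: vP m P + w) = vec_hull x.
Proof. by apply: vec_hull_surj; rewrite -um_dm um_sub_vP. Qed.

(** Split [w] as [um m w *: vP m P + w0]. On [vP m P] the form gives the value of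
    the constant functional [I] at [cm_map m P], which is 1. The differentials of
    [I] and [w0] are both vectors, that of [I] being zero, so that [I] and [w0]
    are orthogonal. *)
Lemma CM_one w : F I w = um m w.
Proof.
pose P : A := origin; pose w0 := (- um m w) *: vP m P + w.
have [y ey] := dm_sub_vP w P.
have e0 : dm I = vec_hull 0.
  apply: Defs.scalarP => s; rewrite dm_one -(vecPP P) vec_hullE subrr //.
rewrite -[X in F I X](_ : um m w *: vP m P + w0 = w); last first.
  by rewrite /w0 scaleNr addNKr.
rewrite -(scale1r w0) form_combr.
rewrite (CM_hess e0 ey) linear0l oppr0 mulr0 addr0.
by rewrite FC CM_vP -[I _]/(1 : R) mulr1.
Qed.

(** When [um m v = 1], [dm v] lies in the affine hyperplane [u = 1] of the hull,
    so it is the evaluation at a point [P], as is [dm (vP m P)]. *)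
Lemma um1_vP v : um m v = 1 -> exists P c, v = vP m P + c *: I.
Proof.
move=> v1; pose O : A := origin.
have [x] := dm_sub_vP v O; rewrite v1 => ex.
exists (trans O x), (v origin - vP m (trans O x) origin); apply: dm_eq => s.
rewrite dm_vP -[s _]/(ev _ s) ev_trans -ex dm_lin dm_vP -[ev O s]/(s O : R).
by rewrite mulN1r addNKr.
Qed.

Lemma CM_um v : F v I = um m v.
Proof. by rewrite FC CM_one. Qed.

(** Write [v = vP m P + c *: I]. Both terms are isotropic and
    [F (vP m P) I = 1], hence [F v v = 2 * c]. *)
Lemma isotropic_vP v : F v v = 0 -> um m v = 1 -> exists P, v = vP m P.
Proof.
move=> v0 v1; have [P [c e]] := um1_vP v1; exists P.
suff c0 : c = 0 by rewrite e c0 scale0r addr0.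
move: v0; rewrite e -{1 2}(scale1r (vP m P)) form_comb_sq// CM_vP_isotropic.
rewrite CM_um um_vP CM_um um_one.
by lra.
Qed.

(** If [F v = 0], then [um m v = F v I = 0], so that [dm v] is a vector [x]. Testing
    against functionals with arbitrary vector differentials gives [x = 0]; the
    functional [v] is then a constant, which is [F v (vP m P) = 0]. *)
Lemma CM_inj : nondegenerate_metric m -> injective (form_map F).
Proof.
move=> m_nondegenerate.
suff ker v : (forall w, F v w = 0) -> v = 0.
  move=> v w e; apply/eqP; rewrite -subr_eq0; apply/eqP/ker => t.
  by rewrite linearBl -[F v t]/(form_map F v t) e subrr.
move=> v0; pose q : QuadM m := cm_map m origin.
have [x ex] : exists x, dm v = vec_hull x.
  by apply: vec_hull_surj; rewrite -um_dm -CM_um.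
have x0 : x = 0.
  apply: m_nondegenerate => y; apply: oppr_inj; rewrite oppr0.
  by rewrite -(CM_hess ex (dm_hull_aff (vec_hull y) q)).
have dv0 : dm v =1 dm (0 : Aff (QuadM m)).
  move=> s; rewrite ex x0 -(vecPP (origin : A)) vec_hullE subrr.
  by rewrite (dmE _ q) subrr.
rewrite (dm_eq q dv0) -(CM_vP origin) FC v0.
by rewrite -[(0 : Aff _) q]/(0 : R) subrr scale0r addr0.
Qed.

(** The preimage is found in the decomposition into constants, multiples of
    [vP m O] and lifts of vectors. The constant and [vP m O] are dual to each
    other for [F], which gives the first two coefficients; the vector [x]
    represents, for [- hess_met m], the restriction of [delta] to the lifts. *)
Lemma CM_surj (delta : hull (QuadM m)) :
  nondegenerate_metric m -> exists v, form_map F v = delta.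
Proof.
move=> m_nondegenerate.
pose O : A := origin; pose q : QuadM m := cm_map m O.
pose T x := hull_aff (vec_hull x) q.
have Tq x : T x q = 0 :> R by rewrite -[LHS]/(vec_hull x (vec q q)) vecPP linear0.
(* The sign is that of [CM_hess]: F (T x) (T y) = - hess_met m x y. *)
have Tlin : scalar (fun x => - delta (T x)).
  move=> a x y; have -> : T (a *: x + y) = a *: T x + T y.
    apply: Aff_eq => q'; rewrite affDE affZE.
    rewrite -[LHS]/(vec_hull _ _) -[T x _]/(vec_hull _ _) -[T y _]/(vec_hull _ _).
    by rewrite -[LHS]/(_ - _) aff_diffD aff_diffZ.
  by rewrite scalar_lin opprD mulrN.
have [x xE] := trivial_nullspace_represents m_nondegenerate (mk_scalar Tlin).
pose v := delta (vP m O) *: I + (delta I *: vP m O + T x).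
exists v; apply: Defs.scalarP => w.
have [y ey] := dm_sub_vP w O.
have Oq : vP m O q = 0 :> R.
  rewrite -[LHS]/(2^-1 * hess_met m (vec O O) (vec O O)).
  by rewrite vecPP linear0r mulr0.
have umT t : um m (T t) = 0 by rewrite um_dm dm_hull_aff dm_vec_hull0.
have wE : w = (um m w *: vP m O + T y) + w q *: I.
  (* The first two summands vanish at [q], which is the zero subtracted here. *)
  rewrite -[w q](subr0 (w q)).
  have -> : 0 = (um m w *: vP m O + T y) q :> R.
    by rewrite affDE affZE Oq Tq mulr0 addr0.
  apply: dm_eq => s; rewrite dm_lin dm_hull_aff -ey dm_lin.
  by rewrite mulNr addNKr.
have vI : F v I = delta I.
  by rewrite CM_um !scalar_lin um_vP umT um_one mulr0 add0r mulr1 addr0.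
have vO : F v (vP m O) = delta (vP m O).
  rewrite FC CM_vP !affDE !affZE Oq Tq -[I q]/(1 : R).
  by rewrite mulr1 mulr0 !addr0.
have vT : F v (T y) = delta (T y).
  rewrite !form_lin CM_one umT CM_vP Tq !mulr0 !add0r.
  rewrite (CM_hess (dm_hull_aff _ _) (dm_hull_aff _ _)) xE.
  by rewrite -[LHS]/(- - delta (T y)) opprK.
rewrite -[LHS]/(F v w) wE -(scale1r (_ + T y)) form_combr -(scale1r (T y)) form_combr.
by rewrite vO vT vI !mul1r !scale1r !linearD !linearZ_LR.
Qed.

End CayleyMengerInverse.

Theorem corollary5p23 (R : realType) (V : vectType R) (A : affineType V)
    (m : Met A) (m_nondegenerate : nondegenerate_metric m) :
  [/\ bijective (form_map (CM m)),
      injective (@cm_map R V A m) &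
      forall delta : hull (QuadM m),
        (exists P : A, delta = ev (cm_map m P)) <->
        form_inv (CM m) delta delta = 0 /\
        form_inv (CM m) delta (um m) = 1].
Proof.
have inj := CM_inj m_nondegenerate.
have surj delta := CM_surj delta m_nondegenerate.
have mapE P : form_map (CM m) (vP m P) = ev (cm_map m P).
  by apply: Defs.scalarP => w; exact: CM_vP.
split.
- exists (fun delta => sval (cid (surj delta))) => [v|delta].
    by apply: inj; rewrite (svalP (cid (surj _))).
  exact: svalP (cid (surj delta)).
- move=> P Q e; apply: ev_inj; apply: Defs.scalarP => s.
  rewrite -[LHS]/(s P : R) -[RHS]/(s Q : R) -!(dm_vP m).
  by congr (dm _ s); apply: inj; rewrite !mapE e.
- move=> delta; have [v <-] := surj delta; rewrite !form_inv_map//; split.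
    by move=> [P]; rewrite -mapE => /inj ->; rewrite um_vP -[form_map _ _ _]/(CM m _ _)
      CM_vP_isotropic.
  by move=> [v0 v1]; have [P ->] := isotropic_vP v0 v1; exists P; exact: mapE.
Qed.
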